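(* Let $\mathcal{L}$ be a finite trim lattice. An element $x\in\mathcal{L}$ is left modular if and only if $x$ lies on some chain of $\mathcal{L}$ of maximal length (i.e. $x$ lies on the spine of $\mathcal{L}$).
   Context: An element $x$ of a lattice is left modular if $(y\vee x)\wedge z=y\vee(x\wedge z)$ for all $y\le z$. A finite lattice of length $n$ (largest $r$ with a chain $x_0<\dots<x_r$) is extremal if it has exactly $n$ join-irreducible and exactly $n$ meet-irreducible elements; it is trim if it is extremal and has a maximal chain consisting of left modular elements. *)

(* Defs.v *)
From mathcomp Require Import all_boot all_order.

Set Implicit Arguments.
Unset Strict Implicit.
Unset Printing Implicit Defensive.

Import Order.Theory.
Local Open Scope order_scope.

Section Lattice.
Context {d : Order.disp_t} {L : finTBLatticeType d}.

Definition left_modular (x : L) : Prop :=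
  forall y z : L, y <= z -> (y `|` x) `&` z = y `|` (x `&` z).

Definition join_irreducible (j : L) : bool :=
  (j != \bot) &&
  [forall y : L, forall z : L, (j == y `|` z) ==> (j == y) || (j == z)].

Definition meet_irreducible (m : L) : bool :=
  (m != \top) &&
  [forall y : L, forall z : L, (m == y `&` z) ==> (m == y) || (m == z)].

Definition chain (C : {set L}) : bool :=
  [forall x in C, forall y in C, x >=< y].

End Lattice.

(* A chain [x_0 < ... < x_r] is encoded by the set of its [r + 1] elements. *)
Definition lattice_length {d : Order.disp_t} (L : finTBLatticeType d) : nat :=
  (\max_(C : {set L} | chain C) #|C|.-1)%N.

Definition extremal {d : Order.disp_t} (L : finTBLatticeType d) : Prop :=
  #|[set j : L | join_irreducible j]| = lattice_length L /\
  #|[set m : L | meet_irreducible m]| = lattice_length L.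

(* [maxset chain C]: [C] is a chain that is maximal for inclusion; it is not
   required to have [(lattice_length L).+1] elements. *)
Definition trim {d : Order.disp_t} (L : finTBLatticeType d) : Prop :=
  extremal L /\
  exists C : {set L}, maxset chain C /\ forall x, x \in C -> left_modular x.

Definition spine {d : Order.disp_t} (L : finTBLatticeType d) : {set L} :=
  \bigcup_(C : {set L} | chain C && (#|C| == (lattice_length L).+1)) C.

(* Main.v *)
(** Fix a maximal chain [c 0 < ... < c r] of left modular elements, and say that
    a pair [y < z] has label [i] when [c i.+1 `&` z] is not below [y `|` c i].
    Left modularity of the [c i] gives every pair a label, and the steps of any
    chain have distinct labels, so [r] is the length [n] of the lattice.  By
    extremality exactly one join-irreducible [j_i] (resp. meet-irreducible
    [m_i]) separates [c i] from [c i.+1], and any pair [y < z] of label [i]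
    satisfies [j_i <= z], [~ j_i <= y], [y <= m_i], [~ z <= m_i].

    A chain of length [n] uses every label, so each of its elements [x]
    satisfies [j_i <= x] or [x <= m_i] for each [i].  Hence for [y < z] of label
    [i], [j_i] separates [x `&` y] from [x `&` z] or [m_i] separates [x `|` y]
    from [x `|` z], and [x] is left modular.  Conversely, if [x] is left modular,
    each step of [c] stays strict after meeting or after joining with [x], so the
    elements [x `&` c i] and [x `|` c i] form a chain of length [n] through [x]. *)

Require Import Defs.
From mathcomp Require Import all_boot all_order.

Set Implicit Arguments.
Unset Strict Implicit.
Unset Printing Implicit Defensive.

Import Order.Theory.
Local Open Scope order_scope.

(** Picking one element of [A] in each of the [n] disjoint classes is injective, so the picks
    already exhaust [A]. *)
Lemma unique_of_disjoint_levels (T : finType) (n : nat) (A : {set T})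
    (P : 'I_n -> pred T) :
  #|A| = n ->
  (forall i, exists2 t, t \in A & P i t) ->
  (forall i k t, P i t -> P k t -> i = k) ->
  forall i, {in A &, forall s t, P i s -> P i t -> s = t}.
Proof.
move=> cardA exP disjP.
have /fin_all_exists [f fP] : forall i, exists t, t \in A /\ P i t.
  by move=> i; have [t tA Pt] := exP i; exists t.
have f_inj : injective f.
  move=> i k fik; have [_ Pi] := fP i; have [_] := fP k.
  by rewrite -fik; apply: disjP.
have fA : f @: [set: 'I_n] = A.
  apply/eqP; rewrite eqEcard card_imset // cardsT card_ord cardA leqnn andbT.
  by apply/subsetP => _ /imsetP [i _ ->]; case: (fP i).
have fE i t : t \in A -> P i t -> t = f i.
  rewrite -fA => /imsetP [k _ ->] Pik.
  by congr f; apply: disjP Pik; case: (fP k).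
by move=> i s t sA tA Ps Pt; rewrite (fE i s) // (fE i t).
Qed.

(** * Irreducibles, chains and left modularity in a finite lattice *)

Section Lattice.
Context {d : Order.disp_t} {L : finTBLatticeType d}.
Implicit Types (x y z w : L) (C D : {set L}).

(** A minimal element among those below [x] but not below [y] has everything strictly under it below
    [y], so it is not a join of smaller elements. *)
Lemma join_irreducible_separates x y :
  ~~ (x <= y) -> exists j, [/\ join_irreducible j, j <= x & ~~ (j <= y)].
Proof.
move=> nxy.
have Px : (x <= x) && ~~ (x <= y) by rewrite lexx.
case: (@arg_minnP _ x (fun w => (w <= x) && ~~ (w <= y))
         (fun w => #|[set v | v <= w]|) Px) => j /andP [jx njy] jmin.
have below v : v < j -> v <= y.
  move=> vj; apply: contraT => nvy.
  have := jmin v; rewrite nvy (le_trans (ltW vj) jx) => /(_ isT).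
  rewrite leqNgt => /negP []; apply: proper_card.
  apply/properP; split.
    by apply/subsetP => w; rewrite !inE => wv; apply: le_trans wv (ltW vj).
  by exists j; rewrite !inE ?lexx ?lt_geF.
exists j; split=> //; apply/andP; split.
  by apply: contraNneq njy => ->; apply: le0x.
apply/forallP => u; apply/forallP => v; apply/implyP => /eqP juv.
apply: contraNT njy; rewrite negb_or => /andP [ju jv].
rewrite juv leUx !below // lt_neqAle eq_sym ?ju ?jv /= juv ?leUl ?leUr //.
Qed.

Lemma chain_enum D :
  chain D -> D != set0 -> exists c : nat -> L,
  [/\ {homo c : i k / (i <= k)%N >-> i <= k},
      forall i, c i \in D,
      forall x, x \in D -> exists2 i, (i < #|D|)%N & c i = x
    & forall i, (i.+1 < #|D|)%N -> c i < c i.+1].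
Proof.
move=> chD /set0Pn [x0 x0D].
have totD : {in mem D &, total (<=%O : rel L)}.
  by move=> x y xD yD; have /forall_inP/(_ x xD)/forall_inP/(_ y yD) := chD.
pose s := sort <=%O (enum D).
have s_sorted : sorted <%O s.
  rewrite lt_sorted_uniq_le sort_uniq enum_uniq /=.
  apply: (sort_sorted_in totD); by apply/allP => x; rewrite mem_enum.
have sD x : (x \in s) = (x \in D) by rewrite mem_sort mem_enum.
have ss : size s = #|D| by rewrite size_sort cardE.
have D_gt0 : (0 < #|D|)%N by apply/card_gt0P; exists x0.
(* Constant from index [#|D|.-1] on, so that monotonicity holds on all of [nat]. *)
pose c i := nth x0 s (minn i #|D|.-1).
have minD i : (minn i #|D|.-1 < size s)%N.
  by rewrite ss; apply: leq_ltn_trans (geq_minr _ _) _; rewrite prednK.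
exists c; split.
- move=> i k ik; rewrite /c lt_sorted_leq_nth ?inE //.
  by rewrite leq_min geq_minr andbT (leq_trans (geq_minl _ _)).
- by move=> i; rewrite -sD mem_nth.
- move=> x; rewrite -sD => xs; have := xs; rewrite -index_mem ss => ixD.
  exists (index x s) => //; rewrite /c (minn_idPl _) ?nth_index //.
  by rewrite -ltnS prednK.
- move=> i iD; rewrite /c lt_sorted_ltn_nth ?inE //.
  have iD' : (i < #|D|.-1)%N by rewrite -ltnS prednK.
  by rewrite (minn_idPl (ltnW iD')) (minn_idPl iD').
Qed.

Lemma maxset_chain_mem C x :
  maxset chain C -> (forall y, y \in C -> x >=< y) -> x \in C.
Proof.
move=> /maxsetP [chC maxC] xC.
suff /maxC <- : chain (x |: C) by [exact: setU11|exact: subsetUr|].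
have in_chC y z : y \in C -> z \in C -> y >=< z.
  by move=> yC zC; have /forall_inP/(_ y yC)/forall_inP/(_ z zC) := chC.
apply/forall_inP => y; rewrite in_setU1 => /predU1P Hy.
apply/forall_inP => z; rewrite in_setU1 => /predU1P Hz.
case: Hy Hz => [->|yC] [->|zC]; [exact: comparablexx|exact: xC| |exact: in_chC].
by rewrite comparable_sym xC.
Qed.

Lemma maxset_chain_enum C :
  maxset chain C -> exists c : nat -> L,
  [/\ {homo c : i k / (i <= k)%N >-> i <= k},
      forall i, c i \in C,
      c 0%N = \bot, c #|C|.-1 = \top
    & forall i, (i < #|C|.-1)%N ->
        c i < c i.+1 /\ forall w, c i < w -> w <= c i.+1 -> w = c i.+1].
Proof.
move=> maxC.
have botC : \bot \in C.
  by apply: (maxset_chain_mem maxC) => y _; apply: le_comparable; apply: le0x.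
have topC : \top \in C.
  by apply: (maxset_chain_mem maxC) => y _; apply: ge_comparable; apply: lex1.
have C0 : C != set0 by apply/set0Pn; exists \bot.
have C_gt0 : (0 < #|C|)%N by rewrite card_gt0.
have [chC _] := maxsetP maxC.
have [c [c_homo cC c_onto c_lt]] := chain_enum chC C0.
exists c; split=> //.
- by have [i _ ci] := c_onto _ botC; apply/eqP; rewrite -lex0 -ci c_homo.
- have [i iC ci] := c_onto _ topC; apply/eqP; rewrite -le1x -ci c_homo //.
  by rewrite -ltnS prednK.
move=> i iC; have ciS : c i < c i.+1 by apply: c_lt; rewrite -ltn_predRL.
split=> // w ciw wci; apply/eqP; apply: contraT => neq_w.
have w_lt : w < c i.+1 by rewrite lt_neqAle neq_w.
(* An element between two consecutive ones is comparable with all of [C], but no index is left for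
   it. *)
have /c_onto [k _ ck] : w \in C.
  apply: (maxset_chain_mem maxC) => y /c_onto [k _ <-].
  case: (leqP k i) => ik; last by apply: le_comparable; apply: le_trans wci (c_homo _ _ ik).
  by apply: ge_comparable; apply: le_trans (c_homo _ _ ik) (ltW ciw).
case: (leqP k i) => ik; have := c_homo _ _ ik; rewrite ck => H.
  by have := lt_le_trans ciw H; rewrite ltxx.
by have := lt_le_trans w_lt H; rewrite ltxx.
Qed.

(** If [y] and [z] had the same meet and the same join with [x], the two sides of the modular law
    would be [z] and [y]. *)
Lemma left_modular_strict x y z :
  left_modular x -> y < z -> (x `&` y < x `&` z) || (x `|` y < x `|` z).
Proof.
move=> xm yz; apply: contraT; rewrite negb_or !lt_neqAle !negb_and !negbK.
rewrite leI2 ?leU2 ?(ltW yz) //= !orbF => /andP [/eqP eI /eqP eU].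
have := xm _ _ (ltW yz).
rewrite (joinC y x) eU (meet_r (leUr _ _)) -eI (join_l (leIr _ _)) => zy.
by rewrite zy ltxx in yz.
Qed.

(** One inequality of the modular law always holds; were it strict, its two sides would be a pair
    excluded by the hypothesis. *)
Lemma left_modular_of_separation x :
  (forall y z, y < z -> ~~ (x `&` z <= y) || ~~ (z <= x `|` y)) ->
  left_modular x.
Proof.
move=> sep y z yz.
have le_lr : y `|` (x `&` z) <= (y `|` x) `&` z.
  by rewrite leUx !lexI leUl yz leIr !andbT /= (le_trans (leIl _ _)) ?leUr.
apply/eqP; apply: contraT => neq.
have /sep : y `|` (x `&` z) < (y `|` x) `&` z by rewrite lt_neqAle eq_sym neq.
case/orP => /negP [].
  by rewrite meetCA meetA (le_trans _ (leUr _ _)) // leI2 ?leIr.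
by apply: le_trans (leIl _ _) _; rewrite leUx leUl (le_trans (leUl y (x `&` z))) ?leUr.
Qed.

(** * Labelling of pairs by a left modular maximal chain *)

Section Labels.
Variables (c : nat -> L) (r : nat).
Hypotheses (c_homo : {homo c : i k / (i <= k)%N >-> i <= k})
  (c_bot : c 0%N = \bot) (c_top : c r = \top)
  (c_cover : forall i, (i < r)%N -> forall w, c i < w -> w <= c i.+1 -> w = c i.+1)
  (c_lm : forall i, left_modular (c i)).

Definition has_label i y z := ~~ (c i.+1 `&` z <= y `|` c i).

(** The label is the step at which the meet of the chain with [z] first fails to be below [y]. The
    meet of [c i] and [z] is still below [y], so by left modularity of [c i] the join of [y] and
    [c i] meets [z] in [y]. *)
Lemma has_label_ex y z : y < z -> exists i : 'I_r, has_label i y z.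
Proof.
move=> yz; have exi : exists i, ~~ (c i `&` z <= y).
  by exists r; rewrite c_top meet1x lt_geF.
case: (ex_minnP exi) => [[|i]]; first by rewrite c_bot meet0x le0x.
move=> ci_nle imin.
have ir : (i < r)%N by apply: imin; rewrite c_top meet1x lt_geF.
exists (Ordinal ir); apply: contra ci_nle => le_i.
have ci_le : c i `&` z <= y.
  by apply: contraT => /imin; rewrite ltnn.
by rewrite -(join_l ci_le) -(c_lm i (ltW yz)) lexI le_i leIr.
Qed.

(** Since [c i.+1] covers [c i], a label [i] forces [c i.+1] below the join of [c i] and [z], hence
    below that of [c i] and any [y'] above [z]. *)
Lemma has_label_disjoint (i : 'I_r) y z y' z' :
  has_label i y z -> z <= y' -> ~~ has_label i y' z'.
Proof.
move=> lab zy'; rewrite negbK.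
have lt_ci : c i < c i `|` (c i.+1 `&` z).
  rewrite lt_neqAle leUl andbT; apply: contra lab => /eqP E.
  by apply: le_trans (leUr _ _); rewrite E leUr.
have E : c i `|` (c i.+1 `&` z) = c i.+1.
  by apply: c_cover => //; rewrite leUx leIl c_homo.
rewrite (le_trans (leIl _ _)) // -{1}E leUx leUr /= (le_trans (leIr _ _)) //.
by rewrite (le_trans zy') ?leUl.
Qed.

(** Injectivity bounds the length of every chain by [r], and makes [f] bijective when [q = r]. *)
Lemma chain_labels (q : nat) (e : nat -> L) :
  {homo e : i k / (i <= k)%N >-> i <= k} ->
  (forall i, (i < q)%N -> e i < e i.+1) ->
  exists2 f : 'I_q -> 'I_r, injective f &
    forall k : 'I_q, has_label (f k) (e k) (e k.+1).
Proof.
move=> e_homo e_lt.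
have /fin_all_exists [f fP] : forall k : 'I_q, exists i : 'I_r, has_label i (e k) (e k.+1).
  by move=> k; apply: has_label_ex; apply: e_lt.
exists f => // k l fkl; apply: val_inj => /=.
have ne (a b : 'I_q) : f a = f b -> (a < b)%N -> False.
  by move=> ab lab; have := has_label_disjoint (e b.+1) (fP a) (e_homo _ _ lab); rewrite ab fP.
by case: (ltngtP k l) => // /ne; case.
Qed.

End Labels.

End Lattice.

(** Meet-irreducibles of [L] are the join-irreducibles of the dual [L^d]. *)
Lemma meet_irreducible_separates (d : Order.disp_t) (L : finTBLatticeType d)
    (x y : L) :
  ~~ (x <= y) -> exists m, [/\ meet_irreducible m, y <= m & ~~ (x <= m)].
Proof. exact: (@join_irreducible_separates _ L^d y x). Qed.

(** * Irreducibles attached to the steps of a chain of length [n] *)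

Section Extremal.
Context {d : Order.disp_t} {L : finTBLatticeType d}.
Variables (c : nat -> L) (n : nat).
Hypotheses (c_homo : {homo c : i k / (i <= k)%N >-> i <= k})
  (c_lt : forall i, (i < n)%N -> c i < c i.+1).

Let level_ltn (i k : nat) (t : L) : t <= c i.+1 -> ~~ (t <= c k) -> (k <= i)%N.
Proof.
by move=> ti; apply: contraNT; rewrite -ltnNge => ik; apply: le_trans ti (c_homo ik).
Qed.

Lemma join_irreducible_unique (i : 'I_n) (s t : L) :
  #|[set j : L | join_irreducible j]| = n ->
  join_irreducible s -> join_irreducible t ->
  s <= c i.+1 -> ~~ (s <= c i) -> t <= c i.+1 -> ~~ (t <= c i) -> s = t.
Proof.
move=> cardJ js jt s1 s2 t1 t2.
pose P (k : 'I_n) := [pred u | (u <= c k.+1) && ~~ (u <= c k)].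
apply: (@unique_of_disjoint_levels _ _ _ P cardJ _ _ i);
  rewrite /= ?inE ?s1 ?t1 //.
  move=> k; have : ~~ (c k.+1 <= c k) by rewrite lt_geF ?c_lt.
  by move=> /join_irreducible_separates [j [jj j1 j2]]; exists j; rewrite /= ?inE ?j1.
move=> k l u /andP [k1 k2] /andP [l1 l2]; apply/val_inj/eqP.
by rewrite eqn_leq (level_ltn l1 k2) (level_ltn k1 l2).
Qed.

Let colevel_ltn (i k : nat) (t : L) : ~~ (c i.+1 <= t) -> c k <= t -> (k <= i)%N.
Proof.
by move=> ti tk; apply: contraNT ti; rewrite -ltnNge => ik; apply: le_trans (c_homo ik) tk.
Qed.

Lemma meet_irreducible_unique (i : 'I_n) (s t : L) :
  #|[set m : L | meet_irreducible m]| = n ->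
  meet_irreducible s -> meet_irreducible t ->
  c i <= s -> ~~ (c i.+1 <= s) -> c i <= t -> ~~ (c i.+1 <= t) -> s = t.
Proof.
move=> cardM ms mt s1 s2 t1 t2.
pose P (k : 'I_n) := [pred u | (c k <= u) && ~~ (c k.+1 <= u)].
apply: (@unique_of_disjoint_levels _ _ _ P cardM _ _ i);
  rewrite /= ?inE ?s1 ?t1 //.
  move=> k; have : ~~ (c k.+1 <= c k) by rewrite lt_geF ?c_lt.
  by move=> /meet_irreducible_separates [m [mm m1 m2]]; exists m; rewrite /= ?inE ?m1.
move=> k l u /andP [k1 k2] /andP [l1 l2]; apply/val_inj/eqP.
by rewrite eqn_leq (colevel_ltn l2 k1) (colevel_ltn k2 l1).
Qed.

(** An irreducible witnessing the label of some pair also separates [c i] from [c i.+1], so by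
    uniqueness it depends on [i] alone. *)
Lemma extremal_label_irreducibles (i : 'I_n) :
  #|[set j : L | join_irreducible j]| = n ->
  #|[set m : L | meet_irreducible m]| = n ->
  exists j m : L, forall y z, has_label c i y z ->
    [/\ j <= z, ~~ (j <= y), y <= m & ~~ (z <= m)].
Proof.
move=> cardJ cardM.
have nci : ~~ (c i.+1 <= c i) by rewrite lt_geF ?c_lt.
have [j [jj j1 j2]] := join_irreducible_separates nci.
have [m [mm m1 m2]] := meet_irreducible_separates nci.
exists j, m => y z lab.
have [j' [jj' j1' j2']] := join_irreducible_separates lab.
have [m' [mm' m1' m2']] := meet_irreducible_separates lab.
have [jc jz] : j' <= c i.+1 /\ j' <= z by apply/andP; rewrite -lexI.
have [ym cm] : y <= m' /\ c i <= m' by apply/andP; rewrite -leUx.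
have -> : j = j'.
  apply: (join_irreducible_unique (i := i)) => //.
  by apply: contra j2' => H; apply: le_trans H (leUr _ _).
have -> : m = m'.
  apply: (meet_irreducible_unique (i := i)) => //.
  by apply: contra m2'; apply: le_trans (leIl _ _).
split=> //.
  by apply: contra j2' => H; apply: le_trans H (leUl _ _).
by apply: contra m2'; apply: le_trans (leIr _ _).
Qed.

Lemma left_modular_chain (x : L) :
  left_modular x -> c 0%N = \bot ->
  exists D : {set L}, [/\ chain D, x \in D & (n < #|D|)%N].
Proof.
move=> xm c_bot.
pose D := [set x `&` c (i : 'I_n.+1) | i : 'I_n.+1] :|: [set x `|` c i | i : 'I_n.+1].
have c_cmp i k : (c i <= c k) || (c k <= c i).
  by case: (leqP i k) => [|/ltnW] ik; rewrite (c_homo ik) ?orbT.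
have chD : chain D.
  apply/forall_inP => y /setUP Hy; apply/forall_inP => z /setUP Hz.
  case: Hy Hz => /imsetP [i _ ->] [] /imsetP [k _ ->].
  - by case/orP: (c_cmp i k) => H; [apply: le_comparable|apply: ge_comparable]; apply: leI2.
  - by apply: le_comparable; apply: le_trans (leIl _ _) (leUl _ _).
  - by apply: ge_comparable; apply: le_trans (leIl _ _) (leUl _ _).
  - by case/orP: (c_cmp i k) => H; [apply: le_comparable|apply: ge_comparable]; apply: leU2.
have xD : x \in D.
  by apply/setUP; right; apply/imsetP; exists ord0; rewrite //= c_bot joinx0.
exists D; split=> //.
pose up i := x `&` c i < x `&` c i.+1.
(* The end different from [x] of a strict step, either
   [x `&` c i < x `&` c i.+1 <= x] or [x <= x `|` c i < x `|` c i.+1]. *)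
pose f (i : 'I_n) := if up i then x `&` c i else x `|` c i.+1.
have upN (i : 'I_n) : ~~ up i -> x `|` c i < x `|` c i.+1.
  by have := left_modular_strict xm (c_lt (ltn_ord i)); rewrite -/(up i) => /orP [->|].
(* [f i < f k], except when [i] is strict only for joins and [k] for meets; then
   [f k <= x < f i]. *)
have f_ne (i k : 'I_n) : (i < k)%N -> f i != f k.
  move=> ik; rewrite /f; case: (boolP (up i)) => ui; case: (boolP (up k)) => uk.
  - by rewrite lt_eqF // (lt_le_trans ui) // leI2 // c_homo.
  - by rewrite lt_eqF // (le_lt_trans _ (upN _ uk)) // (le_trans (leIl _ _)) ?leUl.
  - by rewrite gt_eqF // (le_lt_trans _ (upN _ ui)) // (le_trans (leIl _ _)) ?leUl.
  - by rewrite lt_eqF // (le_lt_trans _ (upN _ uk)) // leU2 // c_homo.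
have f_inj : injective f.
  move=> i k fik; apply: val_inj => /=.
  by case: (ltngtP i k) => // /f_ne; rewrite fik eqxx.
have fD i : f i \in D :\ x.
  rewrite in_setD1 /f; case: (boolP (up i)) => ui; apply/andP; split.
  - by rewrite lt_eqF // (lt_le_trans ui) ?leIl.
  - by apply/setUP; left; apply/imsetP; exists (widen_ord (leqnSn n) i).
  - by rewrite gt_eqF // (le_lt_trans _ (upN _ ui)) ?leUl.
  - by apply/setUP; right; apply/imsetP; exists (lift ord0 i).
rewrite (cardsD1 x) xD add1n ltnS -[leqLHS]card_ord -cardsT.
rewrite -(card_imset _ f_inj); apply: subset_leq_card.
by apply/subsetP => _ /imsetP [i _ ->].
Qed.

End Extremal.

(** * Left modular elements and the spine of a trim lattice *)

Theorem theorem3p7 (d : Order.disp_t) (L : finTBLatticeType d)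
    (htrim : trim L) (x : L) :
  left_modular x <-> x \in spine L.
Proof.
have [[cardJ cardM] [C [maxC lmC]]] := htrim.
have [c [c_homo cC c_bot c_top c_cov]] := maxset_chain_enum maxC.
have c_lm i : left_modular (c i) by apply: lmC.
have c_cover i (ir : (i < #|C|.-1)%N) := (c_cov i ir).2.
have labels := chain_labels c_homo c_bot c_top c_cover c_lm.
have chain_le (D : {set L}) : chain D -> (#|D|.-1 <= #|C|.-1)%N.
  have [->|D0] := eqVneq D set0; first by rewrite cards0.
  move=> /chain_enum/(_ D0) [e [e_homo _ _ e_lt]].
  have [|f f_inj _] := labels #|D|.-1 e e_homo.
    by move=> i; rewrite ltn_predRL; apply: e_lt.
  by have := leq_card f f_inj; rewrite !card_ord.
have chC : chain C by case/maxsetP: maxC.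
(* Inclusion-maximal [C] thus has maximal length, matching the counts of irreducibles. *)
have len : #|C|.-1 = lattice_length L.
  apply/eqP; rewrite eqn_leq leq_bigmax_cond //=.
  by apply/bigmax_leqP.
rewrite len in c_top c_cov c_cover labels chain_le.
have c_lt i ir := (c_cov i ir).1.
split=> [xm|/bigcupP [D /andP [chD /eqP cardD] xD]].
  have [D [chD xD ltD]] := left_modular_chain c_homo c_lt xm c_bot.
  apply/bigcupP; exists D => //; rewrite chD eqn_leq ltD andbT /=.
  by rewrite (leq_trans (leqSpred _)) // ltnS chain_le.
have D0 : D != set0 by apply/set0Pn; exists x.
have [e [e_homo _ e_onto e_lt]] := chain_enum chD D0.
rewrite cardD in e_onto e_lt.
have [//|f f_inj fP] := labels (lattice_length L) e e_homo.
(* [g i] is the step of the chain through [x] with label [i]. *)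
have [g _ gK] := injF_bij f_inj.
have [l _ xE] := e_onto x xD.
apply: left_modular_of_separation => y z yz.
have [i lab_i] := has_label_ex c_bot c_top c_lm yz.
have [j [m sep]] := extremal_label_irreducibles c_homo c_lt i cardJ cardM.
have [jz njy ym nzm] := sep _ _ lab_i.
have := fP (g i); rewrite gK => /sep [jg _ gm _].
(* Up to step [g i] the chain lies below [m]; after it, above [j]. *)
case: (leqP l (g i)) => gl; apply/orP; [right|left].
  apply: contra nzm => H; apply: le_trans H _.
  by rewrite leUx ym andbT -xE (le_trans (e_homo _ _ gl)).
apply: contra njy; apply: le_trans.
by rewrite lexI jz andbT -xE (le_trans jg) // e_homo.
Qed.
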